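(* There is an absolute constant $C>1$ such that for every finite set $U$ of size $N$, every $\epsilon>0$ and every $\Delta\ge 0$, there exists a $(\Delta,\epsilon,\mathcal P(U),L)$-UCS over $U$ with $L(P)\le C^{\,H(P)/\epsilon+\Delta\log^* N}$ for all $P\in\mathcal P(U)$.
   Context: $\mathcal P(U)$ denotes the set of all probability distributions on the finite set $U$; $\{0,1\}^*$ is the set of finite binary strings and $|x|$ the length of $x$. For $P,Q\in\mathcal P(U)$ and $\Delta\ge0$, $P$ and $Q$ are $\Delta$-close if for all $m\in U$, $\log_2(P(m)/Q(m))\le\Delta$ and $\log_2(Q(m)/P(m))\le\Delta$. $H(P)=\sum_{m}P(m)\log_2(1/P(m))$. $\log^{(i)}$ denotes the $i$-fold iterated base-2 logarithm ($\log^{(0)}N=N$), and $\log^* N$ is the least integer $i$ with $\log^{(i)}N\le 1$. For $\Delta\ge0$, $\epsilon\in[0,1]$, a class $\mathcal F\subseteq\mathcal P(U)$ and $L:\mathcal F\to\mathbb R^+$, a $(\Delta,\epsilon,\mathcal F,L)$-UCS over $U$ is a pair $E:\mathcal F\times U\to\{0,1\}^*\cup\{\bot\}$, $D:\mathcal F\times(\{0,1\}^*\cup\{\bot\})\to U\cup\{\bot\}$ such that: (1) for all $\Delta$-close $P,Q\in\mathcal F$ and all $m\in U$, if $E(P,m)\ne\bot$ then $D(Q,E(P,m))=m$, and $D(Q,\bot)=\bot$; (2) for every $P\in\mathcal F$, $\Pr_{m\sim P}[E(P,m)=\bot]\le\epsilon$; (3) for every $P\in\mathcal F$, $\mathbb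 E_{m\sim P}[|E(P,m)|]\le L(P)$ (with $|\bot|$ counted as a constant). *)

(* Defs.v *)
From Stdlib Require Import Reals List.
Open Scope R_scope.

Definition log2 (x : R) : R := ln x / ln 2.

Definition finite_enum {T : Type} (enum : list T) : Prop :=
  NoDup enum /\ forall x : T, In x enum.

Definition sumU {T : Type} (enum : list T) (f : T -> R) : R :=
  fold_right (fun m acc => f m + acc) 0 enum.

Definition is_dist {T : Type} (enum : list T) (P : T -> R) : Prop :=
  (forall m, 0 <= P m) /\ sumU enum P = 1.

(* Delta-closeness: log2(P m/Q m) <= Delta and log2(Q m/P m) <= Delta,
   written multiplicatively (handles zero probabilities). *)
Definition close (Delta : R) {T : Type} (P Q : T -> R) : Prop :=
  forall m, P m <= Rpower 2 Delta * Q m /\ Q m <= Rpower 2 Delta * P m.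

(* Shannon entropy; terms with P m = 0 contribute 0 * _ = 0. *)
Definition entropy {T : Type} (enum : list T) (P : T -> R) : R :=
  sumU enum (fun m => P m * log2 (/ P m)).

Fixpoint logstar_aux (fuel : nat) (x : R) : nat :=
  match fuel with
  | O => O
  | S f => if Rle_dec x 1 then O else S (logstar_aux f (log2 x))
  end.
(* least i with log^(i) N <= 1; fuel N+1 is always sufficient *)
Definition logstar (N : nat) : nat := logstar_aux (S N) (INR N).

Definition bot_len : R := 1.
Definition enc_len (c : option (list bool)) : R :=
  match c with
  | None => bot_len
  | Some s => INR (length s)
  end.

Definition is_UCS {T : Type} (enum : list T) (Delta eps : R) (L : (T -> R) -> R)
  (E : (T -> R) -> T -> option (list bool))
  (D : (T -> R) -> option (list bool) -> option T) : Prop :=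
  (forall P Q, is_dist enum P -> is_dist enum Q -> close Delta P Q ->
     forall m s, E P m = Some s -> D Q (Some s) = Some m)
  /\ (forall Q, is_dist enum Q -> D Q None = None)
  /\ (forall P, is_dist enum P ->
        sumU enum (fun m => match E P m with None => P m | Some _ => 0 end) <= eps)
  /\ (forall P, is_dist enum P ->
        sumU enum (fun m => P m * enc_len (E P m)) <= L P).

(* Main.v *)
(** The encoder uses only the messages [m] with [P m >= 2 ^ - t], where [t] is about
    [H(P) / eps], so by Markov's inequality it fails with probability at most [eps].  It sends [t]
    in unary, followed by a colour of [(P, m)] chosen such that distinct messages get distinct
    colours whenever their distributions are close to a common [Q].

    Such a colouring comes from Linial's colour reduction.  Let the level of [m] be the least [j]
    with [P m >= 2 ^ - (t + 2 j Delta)]; passing to a [2 Delta]-close distribution moves each level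
    by at most one.  Starting from the colour [m], each round replaces the colour [x] by a modulus
    [q] and [x mod q], where [q] divides no difference between [x] and another colour seen by the
    vertex; as [lcm(1, ..., n + 1) >= 2 ^ n], such a [q] exists below about the bit length of the
    product of these differences.  The colour after [i] rounds depends only on the levels truncated
    at [i + 1], and at most [a = 2 ^ (t + O(Delta log* N))] messages have level at most [log* N], so
    a vertex sees at most [3 ^ a * a] colours.  Hence after [log* N] rounds [O(a)] bits remain.

    When [H(P) / eps + Delta log* N < 1 / 4] the bound leaves no room for constants; then the only
    message encoded is the one of probability at least [2 ^ - (1 / 4)], by the empty string. *)
Require Import Defs.
From Stdlib Require Import Reals List ZArith Lia Lra Classical IndefiniteDescription.
Import ListNotations.

(** * Common multiples of an initial segment *)

(* The entry of Leibniz's harmonic triangle in row [k + j] and column [k], equal to the integral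
   of [x ^ k * (1 - x) ^ j] over the unit interval. *)
Definition leibniz (k j : nat) : R := INR (fact k) * INR (fact j) / INR (fact (S (k + j))).

Lemma leibniz_pos k j : 0 < leibniz k j.
Proof.
  unfold leibniz; repeat apply Rmult_lt_0_compat; auto using INR_fact_lt_0.
  apply Rinv_0_lt_compat, INR_fact_lt_0.
Qed.

Lemma leibniz_0_l j : leibniz 0 j = / INR (S j).
Proof.
  unfold leibniz; cbn [Nat.add]; rewrite fact_simpl, mult_INR; simpl (INR (fact 0)).
  field; split; [apply not_0_INR; lia|apply INR_fact_neq_0].
Qed.

Lemma leibniz_split k j : leibniz k j = leibniz (S k) j + leibniz k (S j).
Proof.
  unfold leibniz; rewrite Nat.add_succ_r, Nat.add_succ_l.
  rewrite (fact_simpl (S (k + j))), (fact_simpl k), (fact_simpl j), !mult_INR.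
  replace (INR (S (S (k + j)))) with (INR (S k) + INR (S j))
    by (rewrite <- plus_INR; f_equal; lia).
  pose proof (pos_INR k); pose proof (pos_INR j); rewrite !(S_INR k), !(S_INR j).
  field; split; [apply INR_fact_neq_0|lra].
Qed.

Section CommonMultiple.

Variables n p : nat.
Hypothesis p_pos : (0 < p)%nat.
Hypothesis p_multiple : forall q, (1 <= q <= S n)%nat -> Nat.divide q p.

Lemma leibniz_multiple_integer k j :
  (k + j <= n)%nat -> exists z, INR p * leibniz k j = IZR z.
Proof.
  revert j; induction k as [|k IH]; intros j hkj.
  - destruct (p_multiple (S j)) as [c hc]; [lia|].
    exists (Z.of_nat c); rewrite <- INR_IZR_INZ, leibniz_0_l, hc, mult_INR.
    field; apply not_0_INR; lia.
  - destruct (IH j) as [u hu], (IH (S j)) as [v hv]; [lia..|].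
    exists (u - v)%Z; rewrite minus_IZR, <- hu, <- hv, (leibniz_split k j); ring.
Qed.

Lemma leibniz_multiple_ge i k j : (k + j + i = n)%nat -> 2 ^ i <= INR p * leibniz k j.
Proof.
  revert k j; induction i as [|i IH]; intros k j hn.
  - destruct (leibniz_multiple_integer k j) as [z hz]; [lia|].
    assert (0 < INR p * leibniz k j) as hpos
      by (apply Rmult_lt_0_compat; [now apply lt_0_INR|apply leibniz_pos]).
    rewrite hz in *; apply lt_IZR in hpos; apply (IZR_le 1); lia.
  - pose proof (IH (S k) j ltac:(lia)); pose proof (IH k (S j) ltac:(lia)).
    rewrite leibniz_split, <- tech_pow_Rmult; lra.
Qed.

Lemma common_multiple_ge_pow2 : (2 ^ n <= p)%nat.
Proof.
  apply INR_le; rewrite pow_INR; change (INR 2) with 2.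
  pose proof (leibniz_multiple_ge n 0 0 eq_refl) as h.
  rewrite leibniz_0_l in h; change (INR 1) with 1 in h; lra.
Qed.

End CommonMultiple.

Open Scope nat_scope.

(** * Separation by residues *)

(* The default [1] is reached only when [p] is a multiple of all of [1, ..., n]. *)
Definition least_nondivisor (n p : nat) : nat :=
  match find (fun q => negb (p mod q =? 0)) (seq 1 n) with
  | Some q => q
  | None => 1
  end.

Lemma least_nondivisor_bounds n p : 1 <= n -> 1 <= least_nondivisor n p <= n.
Proof.
  intros hn; unfold least_nondivisor; destruct (find _ _) as [q|] eqn:found; [|lia].
  apply find_some in found as [hq _]; apply in_seq in hq; lia.
Qed.

Lemma least_nondivisor_spec n p :
  0 < p < 2 ^ n -> ~ Nat.divide (least_nondivisor (S n) p) p.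
Proof.
  intros hp; unfold least_nondivisor; destruct (find _ _) as [q|] eqn:found.
  - apply find_some in found as [_ hq].
    rewrite <- Nat.Lcm0.mod_divide; intros e; now rewrite e in hq.
  - exfalso; apply (Nat.lt_nge p (2 ^ n)); [apply hp|].
    apply common_multiple_ge_pow2; [apply hp|]; intros q hq.
    apply Nat.Lcm0.mod_divide, Nat.eqb_eq, Bool.negb_false_iff.
    apply (find_none _ _ found), in_seq; lia.
Qed.

Definition gap (x y : nat) : nat := (x - y) + (y - x).

Definition gap_product (x : nat) (l : list nat) : nat :=
  fold_right (fun y => Nat.mul (gap x y)) 1 (remove Nat.eq_dec x l).

Lemma gap_product_bounds b x l :
  x < 2 ^ b -> (forall y, In y l -> y < 2 ^ b) -> 0 < gap_product x l <= 2 ^ (length l * b).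
Proof.
  intros hx; unfold gap_product; induction l as [|y l IH]; cbn [remove length In Nat.mul];
    intros hl; [simpl; lia|].
  rewrite Nat.pow_add_r; specialize (IH (fun z hz => hl z (or_intror hz))).
  specialize (hl y (or_introl eq_refl)).
  destruct (Nat.eq_dec x y); cbn [fold_right]; [nia|].
  assert (0 < gap x y < 2 ^ b) by (unfold gap; lia).
  split; [lia|apply Nat.mul_le_mono; lia].
Qed.

Lemma gap_divide_product x y l : In y l -> y <> x -> Nat.divide (gap x y) (gap_product x l).
Proof.
  intros hy hxy; apply (in_in_remove Nat.eq_dec) with (y := x) in hy; auto.
  unfold gap_product; induction (remove _ _ _) as [|z r IH]; [destruct hy|].
  destruct hy as [->|hy]; cbn [fold_right].
  - apply Nat.divide_factor_l.
  - now apply Nat.divide_mul_r, IH.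
Qed.

Lemma mod_eq_divide_gap q x y : x mod q = y mod q -> Nat.divide q (gap x y).
Proof.
  intros e; exists (gap (x / q) (y / q)); unfold gap.
  pose proof (Nat.div_mod_eq x q); pose proof (Nat.div_mod_eq y q); nia.
Qed.

Definition modulus_bits (s b : nat) : nat := S (Nat.log2 (s * b + 2)).

Definition separating_modulus (s b x : nat) (l : list nat) : nat :=
  least_nondivisor (s * b + 2) (gap_product x l).

Definition reduce_colour (s b x : nat) (l : list nat) : nat :=
  let q := separating_modulus s b x l in 2 ^ modulus_bits s b * q + x mod q.

Lemma separating_modulus_lt s b x l : 0 < separating_modulus s b x l < 2 ^ modulus_bits s b.
Proof.
  unfold separating_modulus, modulus_bits.
  pose proof (least_nondivisor_bounds (s * b + 2) (gap_product x l)).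
  destruct (Nat.log2_spec (s * b + 2)); lia.
Qed.

Lemma mod_separating_modulus_lt s b x l x' :
  x' mod separating_modulus s b x l < 2 ^ modulus_bits s b.
Proof.
  pose proof (separating_modulus_lt s b x l).
  pose proof (Nat.mod_upper_bound x' (separating_modulus s b x l)); lia.
Qed.

Lemma reduce_colour_lt s b x l : reduce_colour s b x l < 2 ^ (2 * modulus_bits s b).
Proof.
  unfold reduce_colour; pose proof (separating_modulus_lt s b x l).
  pose proof (mod_separating_modulus_lt s b x l x).
  replace (2 * modulus_bits s b) with (modulus_bits s b + modulus_bits s b) by lia.
  rewrite Nat.pow_add_r; nia.
Qed.

Lemma separating_modulus_separates s b x y l :
  x < 2 ^ b -> (forall z, In z l -> z < 2 ^ b) -> length l <= s -> In y l ->
  x mod separating_modulus s b x l = y mod separating_modulus s b x l -> x = y.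
Proof.
  intros hx hl hs hy e; destruct (Nat.eq_dec y x) as [|hxy]; [auto|exfalso].
  assert (0 < gap_product x l < 2 ^ S (s * b)) as hp.
  { pose proof (gap_product_bounds b x l hx hl).
    pose proof (Nat.pow_le_mono_r 2 (length l * b) (s * b)); cbn [Nat.pow]; nia. }
  apply least_nondivisor_spec in hp; apply hp.
  replace (S (S (s * b))) with (s * b + 2) by lia.
  apply Nat.divide_trans with (gap x y);
    [now apply mod_eq_divide_gap|now apply gap_divide_product].
Qed.

Lemma reduce_colour_inj s b x y l l' :
  x < 2 ^ b -> (forall z, In z l -> z < 2 ^ b) -> length l <= s -> In y l ->
  reduce_colour s b x l = reduce_colour s b y l' -> x = y.
Proof.
  intros hx hl hs hy e; unfold reduce_colour in e.
  apply Nat.div_mod_unique in e as [same_modulus same_residue];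
    auto using mod_separating_modulus_lt.
  rewrite <- same_modulus in same_residue.
  now apply (separating_modulus_separates s b x y l).
Qed.

(** * Colour reduction on level vectors *)

Definition adjacent (x y : nat) : Prop := x <= S y /\ y <= S x.

Definition truncate (i : nat) : list nat -> list nat := map (Nat.min i).

Definition count_le (i : nat) (l : list nat) : nat := length (filter (fun x => x <=? i) l).

Definition positions_le (i : nat) (l : list nat) : list nat :=
  filter (fun j => nth j l 0 <=? i) (seq 0 (length l)).

Fixpoint views (i : nat) (l : list nat) : list (list nat) :=
  match l with
  | [] => [[]]
  | x :: r =>
      let choices := if x <=? i then [pred x; x; S x] else [i] in
      flat_map (fun y => map (cons y) (views i r)) choices
  end.

Lemma Forall2_adjacent_nth l l' m :
  Forall2 adjacent l l' -> adjacent (nth m l 0) (nth m l' 0).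
Proof. intros h; revert m; induction h; intros [|m]; cbn; auto; split; lia. Qed.

Lemma truncate_truncate i j l : i <= j -> truncate i (truncate j l) = truncate i l.
Proof. intros hij; unfold truncate; rewrite map_map; apply map_ext; lia. Qed.

Lemma map_nth_seq {A : Type} (d : A) (l : list A) :
  map (fun j => nth j l d) (seq 0 (length l)) = l.
Proof.
  induction l as [|x l IH]; [reflexivity|].
  cbn [length seq map nth]; rewrite <- seq_shift, map_map; now f_equal.
Qed.

Lemma positions_le_length i l : length (positions_le i l) = count_le i l.
Proof.
  unfold positions_le, count_le.
  rewrite <- (map_nth_seq 0 l) at 2; now rewrite filter_map_swap, length_map.
Qed.

Lemma in_positions_le i l m : In m (positions_le i l) <-> m < length l /\ nth m l 0 <= i.
Proof. unfold positions_le; rewrite filter_In, in_seq, Nat.leb_le; lia. Qed.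

Lemma positions_le_truncate i j l :
  i < j -> positions_le i (truncate j l) = positions_le i l.
Proof.
  intros hij; unfold positions_le, truncate; rewrite length_map.
  apply filter_ext; intros m; rewrite <- (Nat.min_0_r j), map_nth, Nat.min_0_r.
  apply Bool.eq_iff_eq_true; rewrite !Nat.leb_le; lia.
Qed.

Lemma count_le_mono i j l : i <= j -> count_le i l <= count_le j l.
Proof.
  intros hij; unfold count_le; induction l as [|x r IH]; [reflexivity|].
  cbn [filter]; destruct (Nat.leb_spec x i), (Nat.leb_spec x j); cbn [length]; lia.
Qed.

Lemma views_truncate i j l : i < j -> views i (truncate j l) = views i l.
Proof.
  intros hij; unfold truncate; induction l as [|x r IH]; [reflexivity|].
  cbn [map views]; rewrite IH.
  destruct (Nat.leb_spec (Nat.min j x) i), (Nat.leb_spec x i); try lia; [|reflexivity].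
  now rewrite Nat.min_r by lia.
Qed.

Lemma truncate_in_views i l l' : Forall2 adjacent l l' -> In (truncate i l') (views i l).
Proof.
  induction 1 as [|x y l l' [hxy hyx] _ IH]; [now left|].
  cbn [truncate map views]; apply in_flat_map; exists (Nat.min i y).
  split; [|now apply in_map].
  destruct (Nat.leb_spec x i); cbn [In]; lia.
Qed.

Lemma views_length i l : length (views i l) = 3 ^ count_le i l.
Proof.
  unfold count_le; induction l as [|x r IH]; [reflexivity|].
  cbn [views filter]; rewrite (flat_map_constant_length (c := length (views i r)))
    by (intros; apply length_map).
  rewrite IH; destruct (x <=? i); cbn [length Nat.pow]; lia.
Qed.

(* A colouring [c] of round [i] only reads [truncate (S i)] of its argument, so that the colours
   of all neighbours can be read off the finitely many views. *)
Definition palette (c : list nat -> nat -> nat) (i : nat) (l : list nat) : list nat :=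
  flat_map (fun v => map (c v) (positions_le 1 l)) (views (S i) l).

Lemma palette_length c i l : length (palette c i l) = 3 ^ count_le (S i) l * count_le 1 l.
Proof.
  rewrite <- views_length, <- positions_le_length; apply flat_map_constant_length.
  intros; apply length_map.
Qed.

Lemma palette_truncate c i l : palette c i (truncate (S (S i)) l) = palette c i l.
Proof. unfold palette; now rewrite views_truncate, positions_le_truncate by lia. Qed.

Section IteratedReduction.

Variables s b : nat.

Definition round_bits (w : nat) : nat := 2 * modulus_bits s w.

Definition colour_bits (i : nat) : nat := Nat.iter i round_bits b.

Fixpoint colour (i : nat) (l : list nat) (m : nat) : nat :=
  match i with
  | O => m
  | S i' => reduce_colour s (colour_bits i') (colour i' l m) (palette (colour i') i' l)
  end.

Lemma colour_truncate i l m : colour i (truncate (S i) l) m = colour i l m.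
Proof.
  revert l m; induction i as [|i IH]; intros l m; [reflexivity|].
  cbn [colour]; rewrite palette_truncate; f_equal.
  now rewrite <- IH, truncate_truncate, IH by lia.
Qed.

Lemma colour_lt i l m : m < 2 ^ b -> colour i l m < 2 ^ colour_bits i.
Proof. destruct i; [auto|intros _; apply reduce_colour_lt]. Qed.

Lemma colour_in_palette i l l' m :
  Forall2 adjacent l l' -> m < length l' -> nth m l' 0 = 0 ->
  In (colour i l' m) (palette (colour i) i l).
Proof.
  intros hadj hm level0; apply in_flat_map; exists (truncate (S i) l').
  split; [now apply truncate_in_views|].
  apply in_map_iff; exists m; split; [apply colour_truncate|].
  apply in_positions_le; rewrite (Forall2_length hadj); split; [assumption|].
  destruct (Forall2_adjacent_nth l l' m hadj); lia.
Qed.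

Lemma colour_inj a i l l' m m' :
  3 ^ a * a <= s -> length l <= 2 ^ b -> count_le i l <= a -> Forall2 adjacent l l' ->
  m < length l -> m' < length l' -> nth m' l' 0 = 0 ->
  colour i l m = colour i l' m' -> m = m'.
Proof.
  intros hs hb; revert l l' m m' hb; induction i as [|i IH]; [auto|].
  intros l l' m m' hb hcount hadj hm hm' level0 e.
  apply (IH l l'); auto.
  { pose proof (count_le_mono i (S i) l); lia. }
  apply reduce_colour_inj in e; auto using colour_in_palette.
  - apply colour_lt; lia.
  - intros z hz; apply in_flat_map in hz as (v & _ & hz).
    apply in_map_iff in hz as (j & <- & hj); apply in_positions_le in hj.
    apply colour_lt; lia.
  - rewrite palette_length; transitivity (3 ^ a * a); [|assumption].
    pose proof (count_le_mono 1 (S i) l).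
    apply Nat.mul_le_mono; [apply Nat.pow_le_mono_r|]; lia.
Qed.

End IteratedReduction.

Definition bits (b n : nat) : list bool := map (Nat.testbit n) (seq 0 b).

Lemma bits_length b n : length (bits b n) = b.
Proof. unfold bits; now rewrite length_map, length_seq. Qed.

Lemma bits_inj b n n' : n < 2 ^ b -> n' < 2 ^ b -> bits b n = bits b n' -> n = n'.
Proof.
  intros hn hn' e; rewrite <- (Nat.mod_small n (2 ^ b)), <- (Nat.mod_small n' (2 ^ b)) by auto.
  apply Nat.bits_inj; intros j; destruct (Nat.lt_ge_cases j b).
  - rewrite !Nat.mod_pow2_bits_low by assumption.
    apply (proj1 map_ext_in_iff e), in_seq; lia.
  - now rewrite !Nat.mod_pow2_bits_high.
Qed.

Lemma unary_prefix_inj (t t' : nat) (w w' : list bool) :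
  repeat true t ++ false :: w = repeat true t' ++ false :: w' -> t = t' /\ w = w'.
Proof.
  revert t'; induction t as [|t IH]; intros [|t'] e; cbn in e; try discriminate.
  - now injection e.
  - injection e as e; apply IH in e as [-> ->]; auto.
Qed.

Open Scope R_scope.

(** * Logarithms and the number of rounds *)

Lemma Rpower_pos x y : 0 < Rpower x y.
Proof. apply exp_pos. Qed.

Lemma Rpower2_le x y : x <= y -> Rpower 2 x <= Rpower 2 y.
Proof. intros; apply Rle_Rpower; lra. Qed.

Lemma Rpower2_ge_1 x : 0 <= x -> 1 <= Rpower 2 x.
Proof. intros; rewrite <- (Rpower_O 2) by lra; now apply Rpower2_le. Qed.

Lemma Rpower2_INR n : Rpower 2 (INR n) = INR (2 ^ n).
Proof. rewrite Rpower_pow, pow_INR by lra; reflexivity. Qed.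

Lemma INR_lt_Rpower2 n : INR n < Rpower 2 (INR n).
Proof. rewrite Rpower2_INR; apply lt_INR, Nat.pow_gt_lin_r; lia. Qed.

Lemma Rpower_log2 x : 0 < x -> Rpower 2 (log2 x) = x.
Proof. intros; apply Rpower_Rlog; lra. Qed.

Lemma log2_Rpower x : log2 (Rpower 2 x) = x.
Proof. unfold log2; rewrite ln_Rpower; field; pose proof ln_lt_2; lra. Qed.

Lemma log2_le x y : 0 < x -> x <= y -> log2 x <= log2 y.
Proof.
  intros hx [hxy| ->]; [|lra]; unfold log2, Rdiv.
  pose proof ln_lt_2; apply Rmult_le_compat_r.
  - left; apply Rinv_0_lt_compat; lra.
  - left; now apply ln_increasing.
Qed.

Lemma log2_le_iff_le_Rpower x y : 0 < x -> log2 x <= y <-> x <= Rpower 2 y.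
Proof.
  intros hx; split; intros h.
  - rewrite <- (Rpower_log2 x hx); now apply Rpower2_le.
  - rewrite <- (log2_Rpower y); now apply log2_le.
Qed.

Lemma le_log2_iff_Rpower_le x y : 0 < y -> x <= log2 y <-> Rpower 2 x <= y.
Proof.
  intros hy; split; intros h.
  - rewrite <- (Rpower_log2 y hy); now apply Rpower2_le.
  - rewrite <- (log2_Rpower x); apply log2_le; [apply Rpower_pos|assumption].
Qed.

Lemma log2_ge_0 x : 1 <= x -> 0 <= log2 x.
Proof. intros; apply le_log2_iff_Rpower_le; [|rewrite Rpower_O]; lra. Qed.

Lemma INR_log2_le n : (0 < n)%nat -> INR (Nat.log2 n) <= log2 (INR n).
Proof.
  intros hn; apply le_log2_iff_Rpower_le; [now apply lt_0_INR|].
  rewrite Rpower2_INR; now apply le_INR, Nat.log2_spec.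
Qed.

(* Unlike the ceiling, [nat_up x] is positive at [x = 0]. *)
Definition nat_up (x : R) : nat := Z.to_nat (up x).

Lemma nat_up_bounds x : 0 <= x -> x < INR (nat_up x) <= x + 1.
Proof.
  intros hx; destruct (archimed x) as [up_gt up_le].
  assert (0 < up x)%Z by (apply lt_IZR; lra).
  unfold nat_up; rewrite INR_IZR_INZ, Z2Nat.id by lia; lra.
Qed.

Lemma logstar_ge_1 N : (1 < N)%nat -> 1 <= INR (logstar N).
Proof.
  intros hN; apply lt_INR in hN; unfold logstar; cbn [logstar_aux].
  destruct (Rle_dec (INR N) 1); [simpl in hN; lra|].
  rewrite S_INR; pose proof (pos_INR (logstar_aux N (log2 (INR N)))); lra.
Qed.

(* The constant 18 is chosen so that [16 * r + 2 * log2 y <= 18 * r * Rmax 1 (log2 y)]: bounds of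
   the form [18 * r * y] then reproduce themselves with [y] replaced by [log2 y]. *)
Lemma round_bits_le r s w y :
  (1 <= r)%nat -> (s <= 2 ^ r)%nat -> 1 <= y -> INR w <= 18 * INR r * y ->
  INR (round_bits s w) <= 16 * INR r + 2 * log2 y.
Proof.
  intros hr hs hy hw; apply (le_INR 1) in hr; simpl in hr.
  apply le_INR in hs; rewrite <- Rpower2_INR in hs.
  unfold round_bits, modulus_bits; rewrite mult_INR, (S_INR (Nat.log2 _)); change (INR 2) with 2.
  enough (INR (Nat.log2 (s * w + 2)) <= INR r + (INR r + (5 + log2 y))) by lra.
  etransitivity; [apply INR_log2_le; lia|].
  apply log2_le_iff_le_Rpower; [apply lt_0_INR; lia|].
  rewrite !Rpower_plus, Rpower_log2, plus_INR, mult_INR by lra; change (INR 2) with 2.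
  replace (Rpower 2 5) with 32
    by (replace 5 with (INR 5) by (simpl; lra); rewrite Rpower2_INR; simpl; lra).
  pose proof (INR_lt_Rpower2 r); pose proof (pos_INR w).
  assert (INR w + 2 <= Rpower 2 (INR r) * (32 * y)) by nra.
  apply Rle_trans with (Rpower 2 (INR r) * (INR w + 2)); [nra|].
  apply Rmult_le_compat_l; lra.
Qed.

Lemma iter_round_bits_le r s f x w :
  (1 <= r)%nat -> (s <= 2 ^ r)%nat -> x <= Rpower 2 (INR f) ->
  INR w <= 18 * INR r * Rmax 1 x ->
  INR (Nat.iter (logstar_aux (S f) x) (round_bits s) w) <= 18 * INR r.
Proof.
  intros hr hs; pose proof (le_INR 1 r hr) as hr'; simpl in hr'.
  revert x w; induction f as [|f IH]; intros x w hx hw.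
  { rewrite Rpower_O in hx by lra; simpl.
    destruct (Rle_dec x 1); [|lra]; simpl.
    rewrite Rmax_left in hw; lra. }
  remember (S f) as f' eqn:def_f'; simpl logstar_aux.
  destruct (Rle_dec x 1); [simpl; rewrite Rmax_left in hw; lra|].
  rewrite Nat.iter_succ_r; subst f'; apply IH.
  - apply log2_le_iff_le_Rpower in hx; [|lra].
    apply Rle_trans with (INR (S f)); [assumption|].
    rewrite Rpower2_INR; apply le_INR, Nat.pow_gt_lin_r; lia.
  - rewrite Rmax_right in hw by lra.
    apply (round_bits_le r s) in hw; [|assumption..|lra].
    pose proof (Rmax_l 1 (log2 x)); pose proof (Rmax_r 1 (log2 x)); nra.
Qed.

Lemma colour_bits_logstar_le r s N :
  (1 <= r)%nat -> (s <= 2 ^ r)%nat -> INR (colour_bits s N (logstar N)) <= 18 * INR r.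
Proof.
  intros hr hs; apply iter_round_bits_le; auto.
  - left; apply INR_lt_Rpower2.
  - apply (le_INR 1) in hr; simpl in hr.
    pose proof (Rmax_l 1 (INR N)); pose proof (Rmax_r 1 (INR N)); nra.
Qed.

(** * Heavy messages *)

Lemma sumU_le {T : Type} (l : list T) (f g : T -> R) :
  (forall m, f m <= g m) -> sumU l f <= sumU l g.
Proof. intros hfg; induction l as [|a l IH]; simpl; [lra|]; specialize (hfg a); lra. Qed.

Lemma sumU_scal {T : Type} (l : list T) (f : T -> R) c :
  sumU l (fun m => f m * c) = sumU l f * c.
Proof. induction l as [|a l IH]; simpl; [lra|]; rewrite IH; lra. Qed.

Lemma sumU_ge_0 {T : Type} (l : list T) (f : T -> R) : (forall m, 0 <= f m) -> 0 <= sumU l f.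
Proof. intros hf; induction l as [|a l IH]; simpl; [lra|]; specialize (hf a); lra. Qed.

Lemma sumU_ge_term {T : Type} (l : list T) (f : T -> R) m :
  (forall m, 0 <= f m) -> In m l -> f m <= sumU l f.
Proof.
  intros hf; induction l as [|a l IH]; [intros []|].
  intros [->|hm]; cbn [sumU fold_right]; fold (sumU l f).
  - pose proof (sumU_ge_0 l f hf); lra.
  - specialize (hf a); specialize (IH hm); lra.
Qed.

Lemma expectation_le {T : Type} (enum : list T) P (f : T -> R) B :
  is_dist enum P -> (forall m, f m <= B) -> sumU enum (fun m => P m * f m) <= B.
Proof.
  intros [hP0 hP1] hf; apply Rle_trans with (sumU enum (fun m => P m * B)).
  - apply sumU_le; intros m; now apply Rmult_le_compat_l.
  - rewrite sumU_scal, hP1; lra.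
Qed.

Lemma surprisal_ge_0 {T : Type} (enum : list T) P m :
  finite_enum enum -> is_dist enum P -> 0 <= P m * log2 (/ P m).
Proof.
  intros [_ in_enum] [hP0 hP1]; pose proof (sumU_ge_term enum P m hP0 (in_enum m)) as hm.
  destruct (hP0 m) as [hpos|<-]; [|lra].
  apply Rmult_le_pos; [lra|]; apply log2_ge_0.
  rewrite <- Rinv_1; apply Rinv_le_contravar; lra.
Qed.

Lemma entropy_ge_0 {T : Type} (enum : list T) P :
  finite_enum enum -> is_dist enum P -> 0 <= entropy enum P.
Proof. intros; apply sumU_ge_0; intros m; now apply (surprisal_ge_0 enum). Qed.

Definition heavy {T : Type} (x : R) (P : T -> R) (m : T) : bool :=
  if Rle_dec (Rpower 2 (- x)) (P m) then true else false.

Lemma heavy_true {T : Type} x (P : T -> R) m :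
  heavy x P m = true <-> Rpower 2 (- x) <= P m.
Proof. unfold heavy; destruct (Rle_dec _ _); intuition discriminate. Qed.

Lemma filter_heavy_length_mass {T : Type} x (P : T -> R) (l : list T) :
  (forall m, 0 <= P m) -> INR (length (filter (heavy x P) l)) * Rpower 2 (- x) <= sumU l P.
Proof.
  intros hP; induction l as [|m l IH]; [simpl; lra|].
  cbn [filter sumU fold_right]; fold (sumU l P).
  unfold heavy at 1; destruct (Rle_dec _ _).
  - cbn [length]; rewrite S_INR; lra.
  - specialize (hP m); lra.
Qed.

Lemma filter_heavy_length_le {T : Type} (enum : list T) P x :
  is_dist enum P -> INR (length (filter (heavy x P) enum)) <= Rpower 2 x.
Proof.
  intros [hP0 hP1]; pose proof (filter_heavy_length_mass x P enum hP0) as hmass.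
  rewrite hP1 in hmass; apply Rmult_le_reg_r with (Rpower 2 (- x)); [apply Rpower_pos|].
  rewrite <- Rpower_plus, Rplus_opp_r, Rpower_O; lra.
Qed.

Lemma light_mass_le {T : Type} (enum : list T) P eps x :
  finite_enum enum -> is_dist enum P -> 0 < eps -> 0 < x -> entropy enum P / eps <= x ->
  sumU enum (fun m => if heavy x P m then 0 else P m) <= eps.
Proof.
  intros henum hP heps hx hH; apply Rmult_le_reg_r with x; [assumption|].
  rewrite <- sumU_scal; apply Rle_trans with (entropy enum P).
  - apply sumU_le; intros m; pose proof (surprisal_ge_0 enum P m henum hP).
    unfold heavy; destruct (Rle_dec _ _) as [|light]; [lra|].
    destruct (proj1 hP m) as [hpos|<-]; [|lra].
    apply Rmult_le_compat_l; [lra|].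
    apply le_log2_iff_Rpower_le; [now apply Rinv_0_lt_compat|].
    rewrite <- (Rinv_inv (Rpower 2 x)), <- Rpower_Ropp; apply Rinv_le_contravar; lra.
  - apply Rmult_le_reg_r with (/ eps); [now apply Rinv_0_lt_compat|].
    replace (eps * x * / eps) with x by (field; lra); exact hH.
Qed.

Lemma length_le_1_unique {A : Type} (l : list A) x y :
  (length l <= 1)%nat -> In x l -> In y l -> x = y.
Proof.
  destruct l as [|u [|v l]]; cbn; [tauto| |lia].
  intros _ [<-|[]] [<-|[]]; reflexivity.
Qed.

Lemma heavy_unique {T : Type} (enum : list T) P x m m' :
  finite_enum enum -> is_dist enum P -> x < 1 ->
  heavy x P m = true -> heavy x P m' = true -> m = m'.
Proof.
  intros [_ in_enum] hP hx hm hm'.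
  apply (length_le_1_unique (filter (heavy x P) enum)); [|now apply filter_In..].
  apply Nat.lt_succ_r, INR_lt, Rle_lt_trans with (Rpower 2 x);
    [now apply filter_heavy_length_le|].
  change (INR 2) with 2; rewrite <- (Rpower_1 2) at 2 by lra; apply Rpower_lt; lra.
Qed.

Lemma close_sym {T : Type} Delta (P Q : T -> R) : close Delta P Q -> close Delta Q P.
Proof. intros h m; destruct (h m); auto. Qed.

Lemma close_trans {T : Type} Delta Delta' (P Q P' : T -> R) :
  close Delta P Q -> close Delta' Q P' -> close (Delta + Delta') P P'.
Proof.
  intros hPQ hQP' m; destruct (hPQ m), (hQP' m); rewrite Rpower_plus.
  pose proof (Rpower_pos 2 Delta); pose proof (Rpower_pos 2 Delta'); split; nra.
Qed.

Lemma Rpower2_le_shift x d p q :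
  p <= Rpower 2 d * q -> Rpower 2 (- x) <= p -> Rpower 2 (- (x + d)) <= q.
Proof.
  intros hpq hp; apply Rmult_le_reg_l with (Rpower 2 d); [apply Rpower_pos|].
  rewrite <- Rpower_plus; replace (d + - (x + d)) with (- x) by lra; lra.
Qed.

Lemma heavy_close {T : Type} Delta (P Q : T -> R) x m :
  close Delta P Q -> heavy x P m = true -> heavy (x + Delta) Q m = true.
Proof. rewrite !heavy_true; intros h; apply Rpower2_le_shift, h. Qed.

Fixpoint level (n : nat) (x d p : R) : nat :=
  match n with
  | O => O
  | S n' => if Rle_dec (Rpower 2 (- x)) p then O else S (level n' (x + d) d p)
  end.

Lemma level_bound n x d p : (level n x d p <= n)%nat.
Proof.
  revert x; induction n as [|n IH]; intros x; simpl; [lia|].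
  destruct (Rle_dec _ _); [lia|]; specialize (IH (x + d)); lia.
Qed.

Lemma level_le_iff n x d p j :
  0 <= d -> (j < n)%nat -> (level n x d p <= j)%nat <-> Rpower 2 (- (x + INR j * d)) <= p.
Proof.
  intros hd; revert x j; induction n as [|n IH]; intros x j hj; [lia|]; simpl level.
  destruct (Rle_dec _ _) as [hx|hx].
  - split; [intros _|lia]; eapply Rle_trans; [|exact hx].
    apply Rpower2_le; pose proof (pos_INR j); nra.
  - destruct j as [|j].
    + simpl INR; rewrite Rmult_0_l, Rplus_0_r; split; [lia|contradiction].
    + rewrite <- Nat.succ_le_mono, IH by lia; rewrite S_INR.
      now replace (x + d + INR j * d) with (x + (INR j + 1) * d) by lra.
Qed.

Lemma level_le_succ n x d p q :
  0 <= d -> p <= Rpower 2 d * q -> (level n x d q <= S (level n x d p))%nat.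
Proof.
  intros hd hpq; pose proof (level_bound n x d q).
  destruct (Nat.lt_ge_cases (S (level n x d p)) n) as [hn|]; [|lia].
  apply level_le_iff; auto; rewrite S_INR.
  replace (x + (INR (level n x d p) + 1) * d) with (x + INR (level n x d p) * d + d) by lra.
  apply Rpower2_le_shift with (1 := hpq), (level_le_iff n); auto; lia.
Qed.

Definition level_vector {T : Type} (enum : list T) (n : nat) (x d : R) (P : T -> R) : list nat :=
  map (fun m => level n x d (P m)) enum.

Lemma level_vector_adjacent {T : Type} (enum : list T) n x d P P' :
  0 <= d -> close d P P' ->
  Forall2 adjacent (level_vector enum n x d P) (level_vector enum n x d P').
Proof.
  intros hd hclose; induction enum as [|m l IH]; constructor; [|exact IH].
  split; apply level_le_succ; auto; apply hclose.
Qed.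

Lemma count_le_level_vector {T : Type} (enum : list T) n x d P i :
  0 <= d -> (i < n)%nat ->
  count_le i (level_vector enum n x d P) = length (filter (heavy (x + INR i * d) P) enum).
Proof.
  intros hd hi; unfold count_le, level_vector; rewrite filter_map_swap, length_map; f_equal.
  apply filter_ext; intros m; apply Bool.eq_iff_eq_true.
  now rewrite Nat.leb_le, heavy_true, level_le_iff.
Qed.

(** * Encoding and decoding *)

Lemma position_exists {T : Type} (enum : list T) :
  finite_enum enum -> exists pos : T -> nat, forall m, nth_error enum (pos m) = Some m.
Proof.
  intros [_ in_enum]; apply (functional_choice (fun m i => nth_error enum i = Some m)).
  intros m; now apply In_nth_error.
Qed.

Section LevelCode.

Context {T : Type} (enum : list T) (pos : T -> nat) (Delta : R).
Hypothesis pos_spec : forall m, nth_error enum (pos m) = Some m.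
Hypothesis Delta_ge_0 : 0 <= Delta.

Definition final_exponent (x : R) : R := x + INR (logstar (length enum)) * (2 * Delta).

Definition heavy_bound (x : R) : nat := nat_up (Rpower 2 (final_exponent x)).

Definition palette_bound (x : R) : nat := 3 ^ heavy_bound x * heavy_bound x.

Definition level_code (x : R) (P : T -> R) (m : T) : list bool :=
  let N := length enum in
  let k := logstar N in
  bits (colour_bits (palette_bound x) N k)
    (colour (palette_bound x) N k (level_vector enum (S k) x (2 * Delta) P) (pos m)).

Lemma heavy_bound_spec x :
  0 <= x ->
  (1 <= heavy_bound x)%nat /\
  Rpower 2 (final_exponent x) <= INR (heavy_bound x) <= 2 * Rpower 2 (final_exponent x).
Proof.
  intros hx; unfold heavy_bound.
  assert (1 <= Rpower 2 (final_exponent x)).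
  { apply Rpower2_ge_1; unfold final_exponent.
    pose proof (pos_INR (logstar (length enum))); nra. }
  destruct (nat_up_bounds (Rpower 2 (final_exponent x))); [lra|].
  split; [apply INR_le; simpl|]; lra.
Qed.

Lemma palette_bound_le x : (palette_bound x <= 2 ^ (3 * heavy_bound x))%nat.
Proof.
  unfold palette_bound; set (a := heavy_bound x).
  replace (3 * a)%nat with (2 * a + a)%nat by lia; rewrite Nat.pow_add_r, Nat.pow_mul_r.
  apply Nat.mul_le_mono; [apply Nat.pow_le_mono_l; simpl; lia|].
  apply Nat.lt_le_incl, Nat.pow_gt_lin_r; lia.
Qed.

Lemma level_code_length x P m :
  0 <= x -> INR (length (level_code x P m)) <= 108 * Rpower 2 (final_exponent x).
Proof.
  intros hx; destruct (heavy_bound_spec x hx) as (ha & _ & ha').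
  unfold level_code; rewrite bits_length.
  eapply Rle_trans; [apply (colour_bits_logstar_le (3 * heavy_bound x)); [lia|]|].
  - apply palette_bound_le.
  - rewrite mult_INR; simpl (INR 3); lra.
Qed.

Lemma nth_level_vector n x d P m :
  heavy x P m = true -> nth (pos m) (level_vector enum n x d P) O = O.
Proof.
  intros hm; apply heavy_true in hm; apply nth_error_nth; unfold level_vector.
  rewrite nth_error_map, pos_spec; cbn [option_map]; f_equal.
  destruct n; simpl; [reflexivity|]; now destruct (Rle_dec _ _).
Qed.

Lemma level_code_inj x P P' m m' :
  0 <= x -> is_dist enum P -> close (2 * Delta) P P' -> heavy x P' m' = true ->
  level_code x P m = level_code x P' m' -> m = m'.
Proof.
  intros hx hP hclose hm' e.
  assert (pos_lt : forall u, (pos u < length enum)%nat)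
    by (intros u; apply nth_error_Some; now rewrite pos_spec).
  assert (pos_lt_pow : forall u, (pos u < 2 ^ length enum)%nat)
    by (intros u; pose proof (Nat.pow_gt_lin_r 2 (length enum)); specialize (pos_lt u); lia).
  apply bits_inj in e; auto using colour_lt.
  apply colour_inj with (a := heavy_bound x) in e.
  - pose proof (pos_spec m); pose proof (pos_spec m'); congruence.
  - reflexivity.
  - unfold level_vector; rewrite length_map; apply Nat.lt_le_incl, Nat.pow_gt_lin_r; lia.
  - apply INR_le; rewrite count_le_level_vector by (lra || lia).
    eapply Rle_trans; [now apply filter_heavy_length_le|now apply heavy_bound_spec].
  - apply level_vector_adjacent; [lra|assumption].
  - unfold level_vector; now rewrite length_map.
  - unfold level_vector; now rewrite length_map.
  - now apply nth_level_vector.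
Qed.

End LevelCode.

Section ThresholdEncoder.

Context {T : Type} (enum : list T) (pos : T -> nat) (eps Delta : R).
Hypothesis enum_finite : finite_enum enum.
Hypothesis pos_spec : forall m, nth_error enum (pos m) = Some m.
Hypothesis eps_gt_0 : 0 < eps.
Hypothesis Delta_ge_0 : 0 <= Delta.

Definition budget (P : T -> R) : R :=
  entropy enum P / eps + Delta * INR (logstar (length enum)).

Definition unary_cutoff (P : T -> R) : nat := nat_up (entropy enum P / eps).

Definition cutoff (P : T -> R) : R :=
  if Rlt_dec (budget P) (1 / 4) then 1 / 4 else INR (unary_cutoff P).

Definition codeword (P : T -> R) (m : T) : list bool :=
  if Rlt_dec (budget P) (1 / 4) then []
  else repeat true (unary_cutoff P) ++
       false :: level_code enum pos Delta (INR (unary_cutoff P)) P m.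

Definition encoder (P : T -> R) (m : T) : option (list bool) :=
  if heavy (cutoff P) P m then Some (codeword P m) else None.

Lemma entropy_ratio_ge_0 P : is_dist enum P -> 0 <= entropy enum P / eps.
Proof.
  intros hP; apply Rmult_le_pos; [now apply entropy_ge_0|].
  left; now apply Rinv_0_lt_compat.
Qed.

Lemma rounds_cost_ge_0 : 0 <= Delta * INR (logstar (length enum)).
Proof. apply Rmult_le_pos; auto using pos_INR. Qed.

Lemma entropy_ratio_le_cutoff P :
  is_dist enum P -> 0 < cutoff P /\ entropy enum P / eps <= cutoff P.
Proof.
  intros hP; pose proof (entropy_ratio_ge_0 P hP) as hratio.
  pose proof (nat_up_bounds _ hratio) as hup.
  pose proof rounds_cost_ge_0.
  unfold cutoff, unary_cutoff, budget in *; destruct (Rlt_dec _ _); lra.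
Qed.

Lemma encoder_failure_le P :
  is_dist enum P ->
  sumU enum (fun m => match encoder P m with None => P m | Some _ => 0 end) <= eps.
Proof.
  intros hP; destruct (entropy_ratio_le_cutoff P hP).
  eapply Rle_trans; [|now apply (light_mass_le enum P eps (cutoff P))].
  apply sumU_le; intros m; unfold encoder; destruct (heavy _ _ _); lra.
Qed.

Lemma heavy_unique_of_small_budget P P' Q m m' :
  budget P < 1 / 4 -> is_dist enum P -> is_dist enum Q ->
  close Delta P Q -> close Delta P' Q ->
  heavy (1 / 4) P m = true -> heavy (1 / 4) P' m' = true -> m = m'.
Proof.
  intros hsmall hP hQ hclose hclose' hm hm'; pose proof (entropy_ratio_ge_0 P hP).
  destruct (le_lt_dec (length enum) 1) as [|hN].
  - apply (length_le_1_unique enum); auto; apply enum_finite.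
  - apply logstar_ge_1 in hN; unfold budget in hsmall.
    apply (heavy_unique enum Q (1 / 4 + Delta)); eauto using heavy_close; nra.
Qed.

Lemma encoder_inj P P' Q m m' w :
  is_dist enum P -> is_dist enum P' -> is_dist enum Q ->
  close Delta P Q -> close Delta P' Q ->
  encoder P m = Some w -> encoder P' m' = Some w -> m = m'.
Proof.
  unfold encoder, cutoff, codeword; intros hP hP' hQ hclose hclose'.
  destruct (Rlt_dec (budget P) (1 / 4)), (Rlt_dec (budget P') (1 / 4)),
    (heavy _ P m) eqn:hm, (heavy _ P' m') eqn:hm'; try discriminate; intros [= e] [= e'].
  - now apply (heavy_unique_of_small_budget P P' Q).
  - subst w; symmetry in e'; now apply app_cons_not_nil in e'.
  - subst w; now apply app_cons_not_nil in e'.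
  - rewrite <- e' in e; apply unary_prefix_inj in e as [same_cutoff e].
    rewrite same_cutoff in e.
    apply (level_code_inj enum pos Delta pos_spec Delta_ge_0) in e; auto using pos_INR.
    replace (2 * Delta) with (Delta + Delta) by lra.
    apply close_trans with Q; auto using close_sym.
Qed.

Lemma codeword_length_le P m :
  is_dist enum P -> INR (length (codeword P m)) <= Rpower 2 (34 * budget P).
Proof.
  intros hP; pose proof (entropy_ratio_ge_0 P hP) as hratio.
  destruct (nat_up_bounds _ hratio) as [_ ht]; fold (unary_cutoff P) in ht.
  pose proof rounds_cost_ge_0.
  unfold codeword; destruct (Rlt_dec _ _) as [|hlarge];
    [left; apply Rpower_pos|apply Rnot_lt_le in hlarge].
  rewrite length_app, repeat_length; cbn [length]; rewrite plus_INR, S_INR.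
  set (t := unary_cutoff P) in *.
  pose proof (level_code_length enum pos Delta Delta_ge_0 (INR t) P m (pos_INR t)) as hcode.
  set (B := Rpower 2 (final_exponent _ _ _)) in hcode.
  assert (0 < B) by apply Rpower_pos.
  assert (INR t + 1 <= 2 * B).
  { pose proof (INR_lt_Rpower2 t); pose proof (Rpower2_ge_1 (INR t) (pos_INR t)).
    assert (Rpower 2 (INR t) <= B) by (apply Rpower2_le; unfold final_exponent; lra); lra. }
  apply Rle_trans with (Rpower 2 (INR 7) * B).
  - rewrite Rpower2_INR; replace (INR (2 ^ 7)) with 128 by (simpl; lra); lra.
  - unfold B; rewrite <- Rpower_plus; apply Rpower2_le.
    unfold final_exponent, budget in *; simpl (INR 7); lra.
Qed.

Lemma encoder_expected_length_le P :
  is_dist enum P ->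
  sumU enum (fun m => P m * enc_len (encoder P m)) <= Rpower 2 (34 * budget P).
Proof.
  intros hP; apply expectation_le; [assumption|intros m].
  unfold encoder; destruct (heavy _ _ _); [now apply codeword_length_le|].
  apply Rpower2_ge_1; unfold budget.
  pose proof (entropy_ratio_ge_0 P hP); pose proof rounds_cost_ge_0; lra.
Qed.

End ThresholdEncoder.

Lemma decoder_exists {T : Type} (enum : list T) Delta
  (E : (T -> R) -> T -> option (list bool)) :
  (forall P P' Q m m' w, is_dist enum P -> is_dist enum P' -> is_dist enum Q ->
     close Delta P Q -> close Delta P' Q -> E P m = Some w -> E P' m' = Some w -> m = m') ->
  exists D : (T -> R) -> option (list bool) -> option T,
    (forall P Q, is_dist enum P -> is_dist enum Q -> close Delta P Q ->
       forall m w, E P m = Some w -> D Q (Some w) = Some m) /\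
    (forall Q, D Q None = None).
Proof.
  intros E_inj.
  set (encodes := fun Q w m =>
    exists P, is_dist enum P /\ is_dist enum Q /\ close Delta P Q /\ E P m = Some w).
  destruct (functional_choice (fun (Qw : (T -> R) * list bool) (o : option T) =>
    forall m, encodes (fst Qw) (snd Qw) m -> o = Some m)) as [decode hdecode].
  { intros [Q w]; destruct (classic (exists m, encodes Q w m)) as [[m (P & hm)]|none].
    - exists (Some m); intros m' (P' & hm'); f_equal.
      destruct hm as (? & ? & ? & ?), hm' as (? & ? & ? & ?).
      now apply (E_inj P P' Q m m' w).
    - exists None; intros m hm; elim none; now exists m. }
  exists (fun Q o => match o with Some w => decode (Q, w) | None => None end); split; auto.
  intros P Q hP hQ hclose m w e; apply hdecode; exists P; auto.
Qed.

Theorem theorem2 :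
  exists C : R, 1 < C /\
    forall (T : Type) (enum : list T), finite_enum enum ->
    forall eps Delta : R, 0 < eps -> 0 <= Delta ->
    exists (E : (T -> R) -> T -> option (list bool))
           (D : (T -> R) -> option (list bool) -> option T),
      is_UCS enum Delta eps
        (fun P => Rpower C (entropy enum P / eps
                            + Delta * INR (logstar (length enum)))) E D.
Proof.
  exists (Rpower 2 34); split.
  { rewrite <- (Rpower_O 2) by lra; apply Rpower_lt; lra. }
  intros T enum henum eps Delta heps hDelta.
  destruct (position_exists enum henum) as [pos pos_spec].
  destruct (decoder_exists enum Delta (encoder enum pos eps Delta)) as (D & decodes & D_bot).
  { intros P P' Q m m' w; now apply encoder_inj. }
  exists (encoder enum pos eps Delta), D.
  split; [exact decodes|split; [auto|split]]; intros P hP.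
  - now apply encoder_failure_le.
  - rewrite Rpower_mult; now apply encoder_expected_length_le.
Qed.
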